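(* Let $(\Omega,\Sigma,\mu)$ be a measure space and let $\Phi:\Omega\times[0,\infty)\to\mathbb{R}$. If $\Phi$ is an $E$-$N$-function, then $\Phi$ is an $E$-strong Young function.
   Context: Let $(\Omega,\Sigma,\mu)$ be a measure space and $\Phi:\Omega\times[0,\infty)\to\mathbb{R}$. $\Phi$ is an $E$-$N$-function if there exists a map $E:\Omega\times[0,\infty)\to\Omega\times[0,\infty)$ such that: for $\mu$-a.e. $t\in\Omega$, the function $u\mapsto\Phi(E(t,u))$ is even (a condition that is vacuous on the domain $[0,\infty)$), continuous and convex on $[0,\infty)$, $\Phi(E(t,u))>0$ for all $u\in(0,\infty)$, $\lim_{u\to0^+}\Phi(E(t,u))/u=0$ and $\lim_{u\to\infty}\Phi(E(t,u))/u=\infty$; and for each $u\in[0,\infty)$ the function $t\mapsto\Phi(E(t,u))$ is $\mu$-measurable on $\Omega$. $\Phi$ is an $E$-strong Young function if there exists a map $E:\Omega\times[0,\infty)\to\Omega\times[0,\infty)$ such that: for $\mu$-a.e. $t\in\Omega$, the function $u\mapsto\Phi(E(t,u))$ is convex and continuous on $[0,\infty)$, $\Phi(E(t,u))=0$ if and only if $u=0$, and $\lim_{u\to\infty}\Phi(E(t,u))=\infty$; and for each $u\in[0,\infty)$ the function $t\mapsto\Phi(E(t,u))$ is $\mu$-measurable on $\Omega$. *)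

(* Defs.v *)
From HB Require Import structures.
From mathcomp Require Import all_boot all_order all_algebra.
From mathcomp Require Import all_classical all_reals all_analysis.
Set Implicit Arguments.
Unset Strict Implicit.
Unset Printing Implicit Defensive.
Import Order.TTheory GRing.Theory Num.Theory.
Import numFieldNormedType.Exports.
Local Open Scope classical_set_scope.
Local Open Scope ring_scope.

(* A function on [0, +oo[ (or on [set: T] `*` [0, +oo[) is represented by a
   total function on R (or on T * R), of which only the values on the domain
   are used. *)
Definition halfline (R : realType) : set R := `[0, +oo[.
Arguments halfline : clear implicits.

Definition maps_domain (R : realType) (T : Type) (E : T * R -> T * R) : Prop :=
  set_fun ([set: T] `*` halfline R) ([set: T] `*` halfline R) E.

(* Vacuous for D = [0, +oo[: both hypotheses force u = 0. *)
Definition even_on (R : realType) (D : set R) (f : R -> R) : Prop :=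
  forall u, D u -> D (- u) -> f (- u) = f u.

Definition E_N_function (d : measure_display) (T : measurableType d)
    (R : realType) (mu : {measure set T -> \bar R}) (Phi : T * R -> R) : Prop :=
  exists E : T * R -> T * R,
    [/\ maps_domain E,
        {ae mu, forall t,
          [/\ even_on (halfline R) (fun u => Phi (E (t, u))),
              {within halfline R, continuous (fun u => Phi (E (t, u)))} /\
              convex_function (halfline R) (fun u => Phi (E (t, u))),
              forall u, 0 < u -> 0 < Phi (E (t, u)),
              Phi (E (t, u)) / u @[u --> 0^'+] --> (0 : R) &
              Phi (E (t, u)) / u @[u --> +oo] --> +oo]} &
        forall u, halfline R u ->
          measurable_fun [set: T] (fun t => Phi (E (t, u)))].

Definition E_strong_Young_function (d : measure_display)
    (T : measurableType d) (R : realType) (mu : {measure set T -> \bar R})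
    (Phi : T * R -> R) : Prop :=
  exists E : T * R -> T * R,
    [/\ maps_domain E,
        {ae mu, forall t,
          [/\ convex_function (halfline R) (fun u => Phi (E (t, u))),
              {within halfline R, continuous (fun u => Phi (E (t, u)))},
              forall u, halfline R u -> (Phi (E (t, u)) = 0 <-> u = 0) &
              Phi (E (t, u)) @[u --> +oo] --> +oo]} &
        forall u, halfline R u ->
          measurable_fun [set: T] (fun t => Phi (E (t, u)))].

(* Main.v *)
Require Import Defs.
From mathcomp Require Import all_boot all_order all_algebra.
From mathcomp Require Import all_classical all_reals all_analysis.
Import Order.TTheory GRing.Theory Num.Theory.
Import numFieldNormedType.Exports.

Local Open Scope classical_set_scope.
Local Open Scope ring_scope.

(** The same map [E] witnesses both notions, and for a fixed [t] only two
    properties of [f u := Phi (E (t, u))] have to be derived from the limits of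
    [f u / u]. Near [0], [f u = (f u / u) * u] tends to [0 * 0], so continuity
    at the endpoint forces [f 0 = 0]; with positivity on the open half-line, [0]
    is then the only zero ([eq0_of_cvg_quotient_at_right]). Near infinity,
    [f u] is at least [f u / u] as soon as [f u >= 0] and [u >= 1], so
    superlinear growth gives growth to infinity ([cvgy_of_cvgy_quotient]). *)

Lemma eq0_of_cvg_quotient_at_right (R : realType) (f : R -> R) :
  {within halfline R, continuous f} ->
  f u / u @[u --> 0^'+] --> (0 : R) -> f 0 = 0.
Proof.
move=> fcont fdiv.
have f_lim0 : f u @[u --> 0^'+] --> (0 : R).
  have id_lim0 : u @[u --> (0 : R)^'+] --> (0 : R).
    exact: cvg_at_right_filter cvg_id.
  rewrite -[X in _ --> X](mulr0 (0 : R)).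
  apply: cvg_trans (cvgM fdiv id_lim0).
  apply: near_eq_cvg; near=> u.
  by rewrite /= mulfVK// gt_eqF.
have f_limf0 : f u @[u --> 0^'+] --> f 0.
  by have /continuous_within_itvcyP[] := fcont.
exact: cvg_unique f_limf0 f_lim0.
Unshelve. all: by end_near. Qed.

Lemma cvgy_of_cvgy_quotient (R : realType) (f : R -> R) :
  (forall u, 0 < u -> 0 <= f u) ->
  f u / u @[u --> +oo] --> +oo -> f u @[u --> +oo] --> +oo.
Proof.
move=> f_ge0 /cvgryPge fdiv; apply/cvgryPge => A; near=> u.
have u_ge1 : 1 <= u by near: u; exact: nbhs_pinfty_ge.
have u_gt0 : 0 < u by exact: lt_le_trans u_ge1.
apply: (@le_trans _ _ (f u / u)); first by near: u; exact: fdiv.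
by rewrite ler_pdivrMr// ler_peMr// f_ge0.
Unshelve. all: by end_near. Qed.

Theorem theorem52 (d : measure_display) (T : measurableType d) (R : realType)
    (mu : {measure set T -> \bar R}) (Phi : T * R -> R) :
  E_N_function mu Phi -> E_strong_Young_function mu Phi.
Proof.
move=> [E [Edom EN Emeas]]; exists E; split=> //.
apply: filterS EN => t [_ [fcont fconv] fpos fdiv0 fdivy]; split=> //; last first.
  by apply: cvgy_of_cvgy_quotient fdivy => u /fpos/ltW.
move=> u; rewrite /halfline /= in_itv/= andbT => u_ge0; split=> [fu0|->].
  apply/eqP; move: u_ge0; rewrite le_eqVlt eq_sym => /orP[//|/fpos].
  by rewrite fu0 ltxx.
exact: eq0_of_cvg_quotient_at_right _ _ fcont fdiv0.
Qed.
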